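(* Let $\{x_k\}_{k\ge 0}$ be generated by the time-varying gradient descent (TVGD) algorithm described in the context, with step size $\beta=1/L_1$. Suppose that (1) $f$ is a $\mu$-PL function in terms of $x$; (2) $f(\cdot;t)$ is twice differentiable with $\|\nabla_{xx}f(x;t)\|\le L_1$ for all $x\in\mathbb{R}^d$, $t\ge 0$; (3) there exists a function $\mathscr{G}:\mathbb{R}\to\mathbb{R}$ such that $|[f(x;s)-\mathscr{G}(s)]-[f(x;t)-\mathscr{G}(t)]|\le G_2|s-t|$ for all $x\in\mathbb{R}^d$ and all $s,t\ge 0$. Let $\rho:=1-\frac{\mu}{L_1}\in[0,1)$. Then the optimality gap $\{f_k-f_k^\ast\}$ is bounded as follows: for all $k\in\mathbb{N}$, $$f_k-f_k^\ast\le\rho^k(f_0-f_0^\ast)+\frac{2(1-\rho^k)}{1-\rho}G_2h.$$ Therefore, the optimality gap converges linearly to an asymptotical error bound: $$\lim_{k\to\infty}(f_k-f_k^\ast)=\frac{2G_2}{1-\rho}h.$$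
   Context: $f:\mathbb{R}^d\times\mathbb{R}\to\mathbb{R}$, $(x,t)\mapsto f(x;t)$, is a time-varying objective function; $h>0$ is the sampling period and $t_k:=kh$. For each $t\ge0$, $x^\ast(t)$ denotes an optimal solution of $\min_{x\in\mathbb{R}^d}f(x;t)$; $f_k^\ast:=\min_{x}f(x;t_k)$, and $f_k:=f(x_k;t_k)$. $\nabla_x$, $\nabla_{xx}$ denote gradient and Hessian in $x$; $\|\cdot\|$ is the Euclidean/operator norm. $L_1$, $\mu$, $G_2$ are constants. PL function: $f$ is a $\mu$-PL (Polyak-Łojasiewicz) function in terms of $x$ if $\frac12\|\nabla_x f(x;t)\|^2\ge\mu(f(x;t)-f(x^\ast(t);t))$ for all $x\in\mathbb{R}^d$ and $t\ge 0$. TVGD algorithm: given $x_0\in\mathbb{R}^d$, a step size $\beta$ and a number of correction steps $C\ge1$, at each time step $k=0,1,2,\dots$ set $\hat x_k^0=x_k$, perform $\hat x_k^{c+1}=\hat x_k^c-\beta\nabla_x f(\hat x_k^c;t_k)$ for $c=0,\dots,C-1$, and set $x_{k+1}=\hat x_k^C$.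
   Formalization: The final limit equality is false in general (for f independent of t the gap tends to 0 while G_2 may be positive); it is replaced by: the upper bound tends to B = 2G_2h/(1-ρ), f_k - f_k^* - B ≤ ρ^k(f_0 - f_0^* - B), and limsup(f_k - f_k^* ) ≤ B. *)

(* Defs.v *)
From HB Require Import structures.
From mathcomp Require Import all_boot all_order all_algebra.
From mathcomp Require Import all_classical all_reals all_analysis.

Set Implicit Arguments.
Unset Strict Implicit.
Unset Printing Implicit Defensive.
Import Order.TTheory GRing.Theory Num.Theory.
Import numFieldNormedType.Exports.
Local Open Scope classical_set_scope.
Local Open Scope ring_scope.

(* Vectors of R^d are row vectors. The library norm `|v| on 'rV[R]_d is the sup
   norm, hence the separate Euclidean norm; both induce the same topology, so
   [differentiable] and 'D_v keep their usual meaning. *)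
Definition enorm (R : realType) (d : nat) (v : 'rV[R]_d) : R :=
  Num.sqrt (\sum_(i < d) v 0 i ^+ 2).

(* Euclidean operator norm of v |-> v *m A. The set is nonempty and bounded, so
   [sup] is a genuine supremum. *)
Definition opnorm (R : realType) (d : nat) (A : 'M[R]_d) : R :=
  sup [set enorm (v *m A) | v in [set v : 'rV[R]_d | enorm v <= 1]].

Definition gradient (R : realType) (d : nat) (g : 'rV[R]_d -> R)
    (x : 'rV[R]_d) : 'rV[R]_d :=
  \row_(i < d) 'D_(delta_mx 0 i) g x.

Definition twice_differentiable (R : realType) (d : nat)
    (g : 'rV[R]_d -> R) : Prop :=
  forall x, differentiable g x /\ differentiable (gradient g) x.

(* The library Jacobian acts on row vectors, so the entry (i, j) is
   d_i (d_j g) (x). *)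
Definition hessian (R : realType) (d : nat) (g : 'rV[R]_d -> R)
    (x : 'rV[R]_d) : 'M[R]_d :=
  jacobian (gradient g) x.

(* min_x f(x; t); this is the minimum whenever the minimum is attained. *)
Definition fmin (R : realType) (d : nat) (f : 'rV[R]_d -> R -> R) (t : R) : R :=
  inf (range (fun x => f x t)).

Definition is_optimal_solution (R : realType) (d : nat)
    (f : 'rV[R]_d -> R -> R) (t : R) (xs : 'rV[R]_d) : Prop :=
  forall x, f xs t <= f x t.

Definition PL_function (R : realType) (d : nat) (mu : R)
    (f : 'rV[R]_d -> R -> R) (xstar : R -> 'rV[R]_d) : Prop :=
  forall (x : 'rV[R]_d) (t : R), 0 <= t ->
    mu * (f x t - f (xstar t) t)
      <= 2^-1 * enorm (gradient (fun y => f y t) x) ^+ 2.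

Definition sample_time (R : realType) (h : R) (k : nat) : R := k%:R * h.

Definition gd_step (R : realType) (d : nat) (f : 'rV[R]_d -> R -> R)
    (beta t : R) (y : 'rV[R]_d) : 'rV[R]_d :=
  y - beta *: gradient (fun z => f z t) y.

(* Time-varying gradient descent: C correction steps at each sampling time. *)
Fixpoint tvgd (R : realType) (d : nat) (f : 'rV[R]_d -> R -> R)
    (h beta : R) (C : nat) (x0 : 'rV[R]_d) (k : nat) : 'rV[R]_d :=
  if k is k'.+1 then
    iter C (gd_step f beta (sample_time h k')) (tvgd f h beta C x0 k')
  else x0.

(* Main.v *)
(* A gradient step of length 1/L decreases an L-smooth function by at least
   |grad|^2 / (2L): restrict to the segment and apply the mean value theorem
   twice. By the PL inequality the gap is then multiplied by at most
   rho = 1 - mu/L, and further correction steps at the same time cannot increase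
   it. Moving from t_k to t_{k+1} changes both f(x; .) and the minimum; the common
   drift G cancels in their difference, which costs at most 2 G2 h. So
   gap_{k+1} <= rho gap_k + 2 G2 h, an affine recurrence with fixed point
   2 G2 h / (1 - rho). *)
Require Import Defs.
From HB Require Import structures.
From mathcomp Require Import all_boot all_order all_algebra.
From mathcomp Require Import all_classical all_reals all_analysis.
From mathcomp Require Import ring lra.

Set Implicit Arguments.
Unset Strict Implicit.
Unset Printing Implicit Defensive.
Import Order.TTheory GRing.Theory Num.Theory.
Import numFieldNormedType.Exports.
Local Open Scope classical_set_scope.
Local Open Scope ring_scope.

(** * Euclidean geometry: Cauchy-Schwarz and the operator norm *)

Definition dot (R : realType) (d : nat) (u v : 'rV[R]_d) : R :=
  \sum_(i < d) u 0 i * v 0 i.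

Lemma sqr_enorm (R : realType) (d : nat) (v : 'rV[R]_d) :
  enorm v ^+ 2 = \sum_(i < d) v 0 i ^+ 2.
Proof. by rewrite sqr_sqrtr// sumr_ge0// => i _; exact: sqr_ge0. Qed.

Lemma enorm_ge0 (R : realType) (d : nat) (v : 'rV[R]_d) : 0 <= enorm v.
Proof. exact: sqrtr_ge0. Qed.

Lemma dotvv (R : realType) (d : nat) (v : 'rV[R]_d) : dot v v = enorm v ^+ 2.
Proof. by rewrite sqr_enorm; apply: eq_bigr => i _; rewrite expr2. Qed.

Lemma enorm0 (R : realType) (d : nat) : enorm (0 : 'rV[R]_d) = 0.
Proof.
by apply/eqP; rewrite -sqrf_eq0 sqr_enorm big1// => i _; rewrite mxE expr0n.
Qed.

Lemma enorm_eq0 (R : realType) (d : nat) (v : 'rV[R]_d) : enorm v = 0 -> v = 0.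
Proof.
move=> v0; apply/rowP => i; rewrite mxE; apply/eqP; rewrite -sqrf_eq0.
have /eqP := sqr_enorm v; rewrite v0 expr0n/= eq_sym psumr_eq0.
  by move=> /allP/(_ i); apply; rewrite mem_index_enum.
by move=> j _; exact: sqr_ge0.
Qed.

Lemma enormZ (R : realType) (d : nat) (c : R) (v : 'rV[R]_d) :
  enorm (c *: v) = `|c| * enorm v.
Proof.
rewrite /enorm -sqrtr_sqr -sqrtrM ?sqr_ge0// mulr_sumr; congr Num.sqrt.
by apply: eq_bigr => i _; rewrite mxE exprMn.
Qed.

Lemma cauchy_schwarz (R : realType) (d : nat) (u v : 'rV[R]_d) :
  dot u v <= enorm u * enorm v.
Proof.
have := enorm_ge0 v; have := enorm_ge0 u.
rewrite le_eqVlt => /predU1P[/esym/enorm_eq0 -> _|u0].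
  by rewrite enorm0 mul0r /dot big1// => i _; rewrite mxE mul0r.
rewrite le_eqVlt => /predU1P[/esym/enorm_eq0 ->|v0].
  by rewrite enorm0 mulr0 /dot big1// => i _; rewrite mxE mulr0.
(* This sum of squares equals 2|u||v|(|u||v| - u.v), and the factor 2|u||v| is positive here. *)
have : 0 <= \sum_(i < d) (enorm v * u 0 i - enorm u * v 0 i) ^+ 2.
  by apply: sumr_ge0 => i _; exact: sqr_ge0.
have -> : \sum_(i < d) (enorm v * u 0 i - enorm u * v 0 i) ^+ 2 =
    enorm v ^+ 2 * enorm u ^+ 2 - 2 * enorm u * enorm v * dot u v
    + enorm u ^+ 2 * enorm v ^+ 2.
  rewrite [in X in _ * X - _ + _]sqr_enorm.
  rewrite [in X in _ + _ * X]sqr_enorm /dot !mulr_sumr -sumrB -big_split/=.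
  by apply: eq_bigr => i _; ring.
have -> : enorm v ^+ 2 * enorm u ^+ 2 - 2 * enorm u * enorm v * dot u v
    + enorm u ^+ 2 * enorm v ^+ 2 =
    (2 * (enorm u * enorm v)) * (enorm u * enorm v - dot u v) by ring.
by rewrite pmulr_rge0 ?subr_ge0// mulr_gt0// mulr_gt0.
Qed.

Lemma norm_dot_le (R : realType) (d : nat) (u v : 'rV[R]_d) :
  `|dot u v| <= enorm u * enorm v.
Proof.
rewrite ler_norml cauchy_schwarz andbT lerNl.
have -> : - dot u v = dot (- u) v.
  by rewrite /dot -sumrN; apply: eq_bigr => i _; rewrite mxE mulNr.
by rewrite (le_trans (cauchy_schwarz _ _))// -scaleN1r enormZ normrN1 mul1r.
Qed.

Lemma enorm_mulmx_le_opnorm (R : realType) (d : nat) (A : 'M[R]_d)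
    (v : 'rV[R]_d) :
  enorm v <= 1 -> enorm (v *m A) <= opnorm A.
Proof.
move=> v1; apply: ub_le_sup; last by exists v.
(* The Frobenius norm of [A] serves as upper bound: Cauchy-Schwarz is applied to each column. *)
exists (Num.sqrt (\sum_(j < d) enorm (col j A)^T ^+ 2)) => _ [z z1 <-].
rewrite ler_wsqrtr// ler_sum// => j _.
have -> : (z *m A) 0 j = dot z (col j A)^T.
  by rewrite mxE; apply: eq_bigr => i _; rewrite !mxE.
rewrite -real_normK ?num_real// lerXn2r ?nnegrE ?enorm_ge0//.
by rewrite (le_trans (norm_dot_le _ _))// ler_piMl ?enorm_ge0.
Qed.

Lemma opnorm_ge0 (R : realType) (d : nat) (A : 'M[R]_d) : 0 <= opnorm A.
Proof.
rewrite -(enorm0 R d) -[in leLHS](mul0mx _ A).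
by rewrite enorm_mulmx_le_opnorm// enorm0.
Qed.

Lemma enorm_mulmx (R : realType) (d : nat) (A : 'M[R]_d) (v : 'rV[R]_d) :
  enorm (v *m A) <= opnorm A * enorm v.
Proof.
have := enorm_ge0 v; rewrite le_eqVlt => /predU1P[/esym/enorm_eq0 ->|v0].
  by rewrite mul0mx enorm0 mulr0.
have := @enorm_mulmx_le_opnorm _ _ A ((enorm v)^-1 *: v).
rewrite -scalemxAl !enormZ ger0_norm ?invr_ge0 ?enorm_ge0//.
by rewrite mulVf ?gt_eqF// lexx => /(_ isT); rewrite ler_pdivrMl// mulrC.
Qed.

(** * Second-order bounds and the descent inequality *)

Lemma quadratic_upper_bound (R : realType) (f df d2f : R -> R) (K s : R) :
    0 <= s ->
    (forall r : R, is_derive r 1 f (df r)) ->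
    (forall r : R, is_derive r 1 df (d2f r)) ->
    (forall r, d2f r <= K) ->
  f s <= f 0 + df 0 * s + K / 2 * s ^+ 2.
Proof.
move=> s0 f1 f2 d2K.
have slope r : 0 <= r -> df r <= df 0 + K * r.
  move=> r0.
  have cdf : {within `[0, r], continuous df}.
    by apply: derivable_within_continuous => x _; exact: ex_derive.
  have [c _] := MVT_segment r0 (fun x _ => f2 x) cdf.
  by rewrite subr0 -lerBlDl => ->; rewrite ler_wpM2r.
(* By [slope], [g] has nonpositive derivative on [0, s], so g s <= g 0 = f 0. *)
pose g r := f r - (df 0 * r + K / 2 * r ^+ 2).
have g1 (r : R) : is_derive r 1 g (df r - (df 0 + K * r)).
  have -> : g = f - (df 0 \*: id + (K / 2) \*: (id * id)) by [].
  by apply: is_derive_eq; rewrite /GRing.scale/=; field.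
have cg : {within `[0, s], continuous g}.
  by apply: derivable_within_continuous => x _; exact: ex_derive.
have [c] := MVT_segment s0 (fun x _ => g1 x) cg.
rewrite in_itv/= => /andP[c0 _] gE.
have : g s - g 0 <= 0.
  by rewrite gE subr0 mulr_le0_ge0// subr_le0 slope.
rewrite /g; lra.
Qed.

(** Both derivatives are limits of the same difference quotient. *)
Lemma is_derive_line (R : realType) (V W : normedModType R) (f : V -> W)
    (y v : V) (s : R) (l : W) :
  is_derive (s *: v + y) v f l -> is_derive s 1 (fun r => f (r *: v + y)) l.
Proof.
have E : (fun h => h^-1 *: ((f \o shift (s *: v + y)) (h *: v) - f (s *: v + y)))
  = (fun h => h^-1 *:
      (((fun r => f (r *: v + y)) \o shift s) (h *: 1%R) - f (s *: v + y))).
  by apply/funext => h; rewrite /= scalerDl addrA /GRing.scale/= mulr1.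
move=> [df dl]; split; first by rewrite /derivable -E.
by rewrite -dl /derive -E.
Qed.

Lemma is_derive_coord (R : realType) (V : normedModType R) (d : nat)
    (g : V -> 'rV[R]_d) (y v : V) (l : 'rV[R]_d) (i : 'I_d) :
  is_derive y v g l -> is_derive y v (fun x => g x 0 i) (l 0 i).
Proof.
move=> [dg gl].
have lim : (fun h => h^-1 *:
    (((fun x => g x 0 i) \o shift y) (h *: v) - g y 0 i)) @ 0^' --> l 0 i.
  rewrite (_ : (fun h => _) = (fun M : 'rV[R]_d => M 0 i) \o
    (fun h => h^-1 *: ((g \o shift y) (h *: v) - g y))); last first.
    by apply/funext => h /=; rewrite !mxE.
  apply: continuous_cvg; first exact: coord_continuous.
  by rewrite -gl.
split; first by apply/cvg_ex; exists (l 0 i).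
by apply/cvg_lim => //.
Qed.

Lemma derive_gradient (R : realType) (d : nat) (f : 'rV[R]_d -> R)
    (x v : 'rV[R]_d) :
  differentiable f x -> 'D_v f x = dot (gradient f x) v.
Proof.
move=> df; rewrite deriveE// {1}(row_sum_delta v) linear_sum.
by apply: eq_bigr => i _; rewrite linearZ/= mxE deriveE// mulrC.
Qed.

Lemma descent (R : realType) (d : nat) (f : 'rV[R]_d -> R) (L : R)
    (x : 'rV[R]_d) :
    0 < L -> twice_differentiable f ->
    (forall y, opnorm (hessian f y) <= L) ->
  f (x - L^-1 *: gradient f x) <= f x - (2 * L)^-1 * enorm (gradient f x) ^+ 2.
Proof.
move=> L0 f2 fL; set v := - gradient f x.
have vE : enorm v ^+ 2 = enorm (gradient f x) ^+ 2.
  by rewrite /v -scaleN1r enormZ normrN1 mul1r.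
pose df r := dot (gradient f (r *: v + x)) v.
pose d2f r := dot (v *m hessian f (r *: v + x)) v.
have f1 (r : R) : is_derive r 1 (fun s => f (s *: v + x)) (df r).
  apply: is_derive_line; rewrite /df -derive_gradient; last by case: (f2 (r *: v + x)).
  by apply: derivableP; apply: diff_derivable; case: (f2 (r *: v + x)).
have f1' (r : R) : is_derive r 1 df (d2f r).
  (* As a finite sum of scaled coordinates, [df] can be differentiated termwise. *)
  have -> : df = \sum_(i < d) (v 0 i \*: fun s => gradient f (s *: v + x) 0 i).
    by apply/funext => s; rewrite fct_sumE; apply: eq_bigr => i _; rewrite mulrC.
  have -> : d2f r = \sum_(i < d) v 0 i *: (v *m hessian f (r *: v + x)) 0 i.
    by apply: eq_bigr => i _; rewrite mulrC.
  apply: is_derive_sum => i; apply: is_deriveZ.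
  apply: (@is_derive_coord _ _ _ (fun s : R => gradient f (s *: v + x)) r 1).
  apply: is_derive_line; have [_ dg] := f2 (r *: v + x).
  by rewrite -deriveEjacobian//; apply: derivableP; exact: diff_derivable.
have d2fL r : d2f r <= L * enorm v ^+ 2.
  apply: (le_trans (cauchy_schwarz _ _)).
  rewrite expr2 mulrA ler_wpM2r ?enorm_ge0//.
  apply: (le_trans (enorm_mulmx _ _)).
  by rewrite ler_wpM2r ?enorm_ge0.
(* At s = 1/L the linear term is -|grad|^2 / L and the quadratic one |grad|^2 / (2L). *)
have := @quadratic_upper_bound _ _ _ _ _ L^-1 _ f1 f1' d2fL.
rewrite invr_ge0 (ltW L0) => /(_ isT).
rewrite /df scale0r add0r.
have -> : dot (gradient f x) v = - enorm (gradient f x) ^+ 2.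
  by rewrite -dotvv /dot -sumrN; apply: eq_bigr => i _;
    rewrite -mulrN; congr (_ * _); rewrite /v mxE.
rewrite vE /v scalerN addrC => /le_trans; apply.
by rewrite le_eqVlt; apply/orP; left; apply/eqP; field; rewrite gt_eqF.
Qed.

(** * The recurrence for the gap and its asymptotics *)

Lemma affine_recurrence (R : realFieldType) (rho c B : R) (u : nat -> R) :
    0 <= rho -> B = rho * B + c -> (forall k, u k.+1 <= rho * u k + c) ->
  forall k, u k - B <= rho ^+ k * (u 0%N - B).
Proof.
move=> rho0 BE uS; elim=> [|k IH]; first by rewrite expr0 mul1r.
rewrite exprS -mulrA; apply: le_trans (ler_wpM2l rho0 IH).
by have := uS k; lra.
Qed.

(** The suprema over tails are ordered in the same way, and limits preserve this order. *)
Lemma limn_esup_le (R : realType) (u v : (\bar R)^nat) :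
  (forall n, u n <= v n)%E -> (limn_esup u <= limn_esup v)%E.
Proof.
move=> uv; rewrite !limn_esup_lim; apply: lee_lim; [exact: is_cvg_esups..|].
near=> n; apply: ge_ereal_sup => _ [k /= nk <-].
by apply: (le_trans (uv k)); apply: ereal_sup_ubound; exists k.
Unshelve. all: by end_near. Qed.

(** The gap is controlled only from above: for f constant in time it may tend to 0 although G2 > 0.
    Hence the asymptotic claim is that the bound tends to [B], that the excess over [B] is at most a
    geometric term, and that the limsup is at most [B]. *)
Theorem theorem3 (R : realType) (d : nat) (f : 'rV[R]_d -> R -> R)
    (xstar : R -> 'rV[R]_d) (h mu L1 G2 rho : R) (C : nat) (x0 : 'rV[R]_d)
    (h_gt0 : 0 < h) (C_ge1 : (1 <= C)%N)
    (xstar_opt : forall t : R, 0 <= t -> is_optimal_solution f t (xstar t))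
    (f_PL : PL_function mu f xstar)
    (f_diff2 : forall t : R, 0 <= t -> twice_differentiable (fun x => f x t))
    (f_hess : forall (x : 'rV[R]_d) (t : R), 0 <= t ->
       opnorm (hessian (fun y => f y t) x) <= L1)
    (f_time : exists G : R -> R, forall (x : 'rV[R]_d) (s t : R),
       0 <= s -> 0 <= t ->
       `|(f x s - G s) - (f x t - G t)| <= G2 * `|s - t|)
    (rhoE : rho = 1 - mu / L1) (rho01 : 0 <= rho < 1) :
  let x := tvgd f h (1 / L1) C x0 in
  let gap k := f (x k) (sample_time h k) - fmin f (sample_time h k) in
  let bound k :=
    rho ^+ k * gap 0%N + 2 * (1 - rho ^+ k) / (1 - rho) * G2 * h in
  let B := 2 * G2 / (1 - rho) * h in
  [/\ forall k : nat, gap k <= bound k,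
      bound k @[k --> \oo] --> B,
      forall k : nat, gap k - B <= rho ^+ k * (gap 0%N - B) &
      (limn_esup (fun k => (gap k)%:E) <= B%:E)%E].
Proof.
set x := tvgd _ _ _ _ _ => /=.
have L0 : 0 < L1.
  (* An operator norm bounded by [L1] gives L1 >= 0. If L1 = 0, the convention 1/0 = 0 would give
     rho = 1. *)
  rewrite lt_neqAle (le_trans (opnorm_ge0 _) (f_hess x0 0 (lexx _))) andbT.
  by apply/eqP => L0; move: rho01; rewrite rhoE -L0 invr0 mulr0 subr0 ltxx andbF.
have [G fG] := f_time.
set B := 2 * G2 / (1 - rho) * h.
pose t := sample_time h.
have t0 k : 0 <= t k by rewrite mulr_ge0 ?ler0n ?ltW.
have fminE (s : R) : 0 <= s -> fmin f s = f (xstar s) s.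
  move=> s0; apply/eqP; rewrite eq_le; apply/andP; split.
    apply: ge_inf; last by exists (xstar s).
    by exists (f (xstar s) s) => _ [y _ <-]; exact: xstar_opt.
  apply: lb_le_inf; first by exists (f (xstar s) s), (xstar s).
  by move=> _ [y _ <-]; exact: xstar_opt.
pose gap k := f (x k) (t k) - fmin f (t k).
pose bound k := rho ^+ k * gap 0%N + 2 * (1 - rho ^+ k) / (1 - rho) * G2 * h.
have stepE (s : R) y : 0 <= s ->
    f (gd_step f (1 / L1) s y) s - fmin f s <= rho * (f y s - fmin f s).
  move=> s0; rewrite /gd_step div1r.
  have := descent y L0 (f_diff2 s s0) (fun z => f_hess z s s0).
  have := f_PL y s s0; rewrite fminE//; set g := enorm _ => PL D.
  rewrite (le_trans (lerB D (lexx _)))// rhoE.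
  have : L1^-1 * (mu * (f y s - f (xstar s) s)) <= L1^-1 * (2^-1 * g ^+ 2).
    by rewrite ler_pM2l ?invr_gt0.
  (* PL divided by [L1] bounds the decrease |grad|^2 / (2 L1) below by mu / L1 times the gap. *)
  rewrite invfM; set q := L1^-1; set p := 2^-1. nra.
have iterE n (s : R) y : 0 <= s ->
    f (iter n.+1 (gd_step f (1 / L1) s) y) s - fmin f s <= rho * (f y s - fmin f s).
  move=> s0; elim: n => [|n IH]; first exact: stepE.
  rewrite iterS; apply: (le_trans (stepE _ _ s0)).
  apply: le_trans IH.
  (* Only one factor [rho] is kept; each later step uses just rho <= 1 and a nonnegative gap. *)
  rewrite -[leRHS]mul1r ler_wpM2r//; last by case/andP: rho01 => _ /ltW.
  by rewrite subr_ge0 fminE//; exact: xstar_opt.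
have gapS k : gap k.+1 <= rho * gap k + 2 * G2 * h.
  have step : f (x k.+1) (t k) - fmin f (t k) <= rho * gap k.
    have -> : x k.+1 = iter C.-1.+1 (gd_step f (1 / L1) (t k)) (x k).
      by rewrite prednK.
    exact: iterE.
  have tS : t k.+1 - t k = h by rewrite /t /sample_time -natr1; ring.
  (* The drift is compared at x_{k+1} and at the new minimizer, whose value at t_k is at least the
     old minimum. The increments of [G] cancel, and each comparison costs G2 h. *)
  have d1 := fG (x k.+1) _ _ (t0 k.+1) (t0 k).
  have d2 := fG (xstar (t k.+1)) _ _ (t0 k.+1) (t0 k).
  have opt := xstar_opt _ (t0 k) (xstar (t k.+1)).
  move: d1 d2 step; rewrite tS (gtr0_norm h_gt0) /gap !fminE// !ler_norml.
  move=> /andP[_ d1] /andP[d2 _] step; lra.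
have gapB k : gap k - B <= rho ^+ k * (gap 0%N - B).
  apply: affine_recurrence gapS k; first by case/andP: rho01.
  by rewrite /B; field; lra.
have boundE k : bound k = rho ^+ k * (gap 0%N - B) + B.
  by rewrite /bound /B; field; lra.
have gap_bound k : gap k <= bound k by rewrite boundE -lerBlDr.
have bound_cvg : bound k @[k --> \oo] --> B.
  rewrite (_ : bound = fun k => rho ^+ k * (gap 0%N - B) + B); last exact/funext.
  rewrite -[X in _ --> X]add0r -[X in _ --> X + _](mul0r (gap 0%N - B)).
  apply: cvgD; last exact: cvg_cst.
  apply: cvgMr_tmp; apply: cvg_expr; rewrite ger0_norm; lra.
split=> //.
apply: (@le_trans _ _ (limn_esup (EFin \o bound))).
  by apply: limn_esup_le => k; rewrite lee_fin; exact: gap_bound.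
have cb : (EFin \o bound) @ \oo --> B%:E by apply: cvg_EFin => //; exact: nearW.
(* The bound converges, so its limsup is its limit [B]. *)
rewrite is_cvg_limn_esupE; last by apply/cvg_ex; exists B%:E.
by rewrite (cvg_lim _ cb).
Qed.
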